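(* Let $A_0,\dots,A_{n-1}$ be overlapping Boolean algebras such that for every $m<n$: (a) $A_m$ commutatively reflects $(A_i)_{i<m}$, and (b) the subalgebras $(A_i\cap A_m)_{i<m}$ commute in $A_m$. Then there are Boolean algebras $B_m$ for $m\le n$ such that each $B_m$, together with the inclusion maps $A_i\to B_m$ ($i<m$), is a pushout of $(A_i)_{i<m}$, and $A_i\le B_j$ and $B_i\le B_j$ for all $i<j\le n$.
   Context: Boolean algebras $(A_i)_{i<n}$ overlap if for all $i,j$ each Boolean operation of $A_i$ (including the constants $0,1$), restricted to $A_i\cap A_j$, equals the corresponding restricted operation of $A_j$; in particular $A_i\cap A_j$ is a common subalgebra. Pushout: for overlapping $(A_i)_{i<m}$, a pushout $\boxplus_{i<m}A_i$ is a colimit, with coprojections $\iota_i\colon A_i\to\boxplus_{i<m}A_i$, of the diagram of inclusions $\bigcap_{i\in t}A_i\to\bigcap_{i\in s}A_i$ for $\emptyset\ne s\subseteq t\subseteq m$. Concretely it may be taken as the quotient of the free product $\bigoplus_{i<m}A_i$ by the ideal generated by the elements $c_i(x)\wedge c_j(-x)$ for $x\in A_i\cap A_j$ ($c_i$ the cofactor maps), with $\iota_i(x)$ the class of $c_i(x)$. Commuting: subalgebras $C_0,\dots,C_{k-1}$ of a Boolean algebra $D$ commute in $D$ if the unique homomorphism $\boxplus_{i<k}C_i\to D$ extending the inclusions $C_i\to D$ is injective. Commutative reflection: a set $M$ commutatively reflects overlapping $(A_i)_{i<m}$ if (1) $A_i\cap M$ is a subalgebra of $A_i$ for every $i<m$;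 (2) the subalgebras $(\iota_i[A_i\cap M])_{i<m}$ commute in $\boxplus_{i<m}A_i$; and (3) for each $i<m$, $\iota_i[A_i]\cap\langle\bigcup_{j<m}\iota_j[A_j\cap M]\rangle=\iota_i[A_i\cap M]$ in $\boxplus_{i<m}A_i$, where $\langle S\rangle$ denotes the generated subalgebra. *)

(* Defs.v *)
From HB Require Import structures.
From mathcomp Require Import all_boot all_order.
From mathcomp Require Import boolp classical_sets.

Set Implicit Arguments.
Unset Strict Implicit.
Unset Printing Implicit Defensive.

Import Order.Theory.
Local Open Scope classical_set_scope.
Local Open Scope order_scope.

(* Boolean algebras are MathComp's complemented distributive lattices with
   bottom and top ([ctbDistrLatticeType]); the one-element algebra is allowed. *)

(* A Boolean algebra whose underlying set is a subset of the ambient type [U]: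
   an element [x] of the algebra is identified with [ba_val x : U], so that
   several such algebras can share elements. *)
Record balg (U : Type) := BAlg {
  ba_disp : Order.disp_t;
  ba_sort :> ctbDistrLatticeType ba_disp;
  ba_val : ba_sort -> U;
  ba_inj : injective ba_val }.

Definition elts (U : Type) (A : balg U) : set U := range (@ba_val U A).

Definition balg_map (U V : Type) (j : U -> V) (jI : injective j) (A : balg U) :
  balg V := BAlg (inj_comp jI (@ba_inj U A)).

Definition overlap (U : Type) (A B : balg U) : Prop :=
  [/\ ba_val (\bot : A) = ba_val (\bot : B),
      ba_val (\top : A) = ba_val (\top : B),
      forall (x : A) (x' : B), ba_val x = ba_val x' ->
        ba_val (~` x) = ba_val (~` x'),
      forall (x y : A) (x' y' : B), ba_val x = ba_val x' ->
        ba_val y = ba_val y' -> ba_val (x `&` y) = ba_val (x' `&` y') &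
      forall (x y : A) (x' y' : B), ba_val x = ba_val x' ->
        ba_val y = ba_val y' -> ba_val (x `|` y) = ba_val (x' `|` y')].

(* [A <= B], as a subalgebra, for algebras on subsets of [U] *)
Definition subalgebra (U : Type) (A B : balg U) : Prop :=
  elts A `<=` elts B /\ overlap A B.

Section Subalgebras.
Context {d : Order.disp_t} {D : ctbDistrLatticeType d}.

Definition subalg_closed (S : set D) : Prop :=
  [/\ S \bot, S \top,
      forall x, S x -> S (~` x),
      forall x y, S x -> S y -> S (x `&` y) &
      forall x y, S x -> S y -> S (x `|` y)].

Definition generated (S : set D) : set D := smallest subalg_closed S.

Record subalg := Subalg {
  subalg_set :> set D;
  subalg_setP : subalg_closed subalg_set }.

Definition subalg_type (C : subalg) : Type := {x : D | x \in subalg_set C}.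

Section Instances.
Variable C : subalg.

HB.instance Definition _ :=
  SubChoice.copy (subalg_type C) {x : D | x \in subalg_set C}.

Fact subalg_meet : Order.ClosedPredicates.meet_closed [pred x | x \in subalg_set C].
Proof.
move=> x y /set_mem xC /set_mem yC; apply/mem_set.
by case: (subalg_setP C) => _ _ _ + _; apply.
Qed.

Fact subalg_join : Order.ClosedPredicates.join_closed [pred x | x \in subalg_set C].
Proof.
move=> x y /set_mem xC /set_mem yC; apply/mem_set.
by case: (subalg_setP C) => _ _ _ _; apply.
Qed.

Fact subalg_bot : \bot \in [pred x | x \in subalg_set C].
Proof. by apply/mem_set; case: (subalg_setP C). Qed.

Fact subalg_top : \top \in [pred x | x \in subalg_set C].
Proof. by apply/mem_set; case: (subalg_setP C). Qed.

HB.instance Definition _ := Order.SubChoice_isTBSubLattice.Build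
  d D _ d (subalg_type C) subalg_meet subalg_join subalg_bot subalg_top.

Fact subalg_meetUl : @left_distributive (subalg_type C) _ Order.meet Order.join.
Proof. by move=> x y z; apply: val_inj; exact: meetUl. Qed.

HB.instance Definition _ :=
  Order.Lattice_Meet_isDistrLattice.Build d (subalg_type C) subalg_meetUl.

Fact subalg_complP (x : subalg_type C) : ~` (val x) \in subalg_set C.
Proof.
apply/mem_set; case: (subalg_setP C) => _ _ + _ _; apply.
exact/set_mem/(valP x).
Qed.

Definition subalg_compl (x : subalg_type C) : subalg_type C :=
  exist _ (~` (val x)) (subalg_complP x).

Fact subalg_joinxC (x : subalg_type C) : x `|` subalg_compl x = \top.
Proof. by apply: val_inj; exact: joinxC. Qed.

Fact subalg_meetxC (x : subalg_type C) : x `&` subalg_compl x = \bot.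
Proof. by apply: val_inj; exact: meetxC. Qed.

HB.instance Definition _ := Order.TBDistrLattice_hasComplement.Build
  d (subalg_type C) subalg_joinxC subalg_meetxC.

Definition balg_of_subalg : balg D :=
  @BAlg D d (subalg_type C : ctbDistrLatticeType d) val val_inj.

End Instances.
End Subalgebras.
Arguments subalg {d} D.

Section Homomorphisms.
Context {d d' : Order.disp_t}.
Context {D : ctbDistrLatticeType d} {C : ctbDistrLatticeType d'}.

(* [f], restricted to the subalgebra [S] of [D], is a homomorphism *)
Definition hom_on (S : set D) (f : D -> C) : Prop :=
  [/\ f \bot = \bot, f \top = \top,
      forall x, S x -> f (~` x) = ~` f x,
      forall x y, S x -> S y -> f (x `&` y) = f x `&` f y &
      forall x y, S x -> S y -> f (x `|` y) = f x `|` f y].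

Definition hom (f : D -> C) : Prop := hom_on [set: D] f.

End Homomorphisms.

Section Pushouts.
Context {U : Type} {m : nat}.
Variable A : 'I_m -> balg U.

Definition common (s : {set 'I_m}) : set U :=
  [set u | forall i, i \in s -> elts (A i) u].

(* A cocone under the diagram of the inclusions [common t -> common s], for
   nonempty [s \subset t]. Only the values of [g s] on [common s] matter; the
   Boolean structure of [common s] is that of [A i], for any [i] in [s]. *)
Definition cocone (d : Order.disp_t) (C : ctbDistrLatticeType d)
    (g : {set 'I_m} -> U -> C) : Prop :=
  (forall (s : {set 'I_m}) (i : 'I_m), i \in s ->
     hom_on [set x : A i | common s (ba_val x)] (fun x => g s (ba_val x))) /\
  (forall s t : {set 'I_m}, s != finset.set0 -> s \subset t ->
     forall u, common t u -> g t u = g s u).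

Definition colimit (d : Order.disp_t) (P : ctbDistrLatticeType d)
    (l : {set 'I_m} -> U -> P) : Prop :=
  cocone l /\
  forall (d' : Order.disp_t) (C : ctbDistrLatticeType d')
    (g : {set 'I_m} -> U -> C), cocone g ->
    exists! h : P -> C, hom h /\
      forall s : {set 'I_m}, s != finset.set0 ->
        forall u, common s u -> h (l s u) = g s u.

(* The coprojections are the components of the colimit cocone at the
   singletons [s], for which [common s] is the underlying set of [A i]. *)
Definition pushout (d : Order.disp_t) (P : ctbDistrLatticeType d)
    (iota : forall i, A i -> P) : Prop :=
  exists l : {set 'I_m} -> U -> P, colimit l /\
    forall i (x : A i), l [set i]%SET (ba_val x) = iota i x.

End Pushouts.

(* Pushouts exist and are unique up to a unique isomorphism, so that the
   quantification over all of them amounts to using any one of them. *)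
Definition commute_in (d : Order.disp_t) (D : ctbDistrLatticeType d) (k : nat)
    (S : 'I_k -> set D) : Prop :=
  exists C : 'I_k -> subalg D, (forall i, subalg_set (C i) = S i) /\
    forall (d' : Order.disp_t) (P : ctbDistrLatticeType d')
      (iota : forall i, balg_of_subalg (C i) -> P), pushout iota ->
    forall h : P -> D, hom h ->
      (forall i (x : balg_of_subalg (C i)), h (iota i x) = ba_val x) ->
      injective h.

Arguments commute_in [d] D [k] S.

Definition commutatively_reflects (U : Type) (M : set U) (m : nat)
    (A : 'I_m -> balg U) : Prop :=
  let AM i : set (A i) := [set x | M (ba_val x)] in
  (forall i, subalg_closed (AM i)) /\
  forall (d : Order.disp_t) (P : ctbDistrLatticeType d)
    (iota : forall i, A i -> P), pushout iota ->
    commute_in P (fun i => iota i @` AM i) /\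
    forall i, (range (iota i) `&` generated (\bigcup_j (iota j @` AM j))
               = iota i @` AM i)%classic.

Definition pushout_by_inclusions (U : Type) (m : nat) (A : 'I_m -> balg U)
    (B : balg U) : Prop :=
  exists iota : forall i, A i -> B,
    (forall i (x : A i), ba_val (iota i x) = ba_val x) /\ pushout iota.

(* the subfamily [(A i)_(i < m)] of [(A i)_(i < n)] *)
Definition initial (T : Type) (n : nat) (A : 'I_n -> T) (m : nat)
    (le_mn : (m <= n)%N) : 'I_m -> T :=
  fun i => A (widen_ord le_mn i).

(* Main.v *)
Require Import Defs.
From mathcomp Require Import all_boot all_order.
From mathcomp Require Import boolp classical_sets.

(* The pushout is realised dually: its Stone space consists of the maps
   [f : U -> bool] that are homomorphisms on every [A i], and the pushout is the
   algebra of sets of such points generated by the clopen sets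
   [clopen x = {f | f x}]. All the [B m] are subalgebras of the one for the whole
   family, generated by the [clopen x] with [x] in [A i], [i < m]. By (b), a point
   of [(A i)_(i < m)] restricts to a compatible family of ultrafilters on the
   [A i] meeting [A m], hence extends to a point of [(A i)_(i < m.+1)]; so [B m] is
   a pushout of [(A i)_(i < m)]. Hypothesis (a) serves to show that [clopen x]
   determines [x]: by (a2) every ultrafilter of [A m] extends to a point, and if
   [clopen x = clopen y] with [x] in [A i], [i < m], and [y] in [A m], then no two
   ultrafilters of [B m] that agree on the trace of [A m] can separate [clopen x],
   so that it lies in the subalgebra generated by the trace, and (a3) applies. *)

Local Open Scope classical_set_scope.

Section BooleanAlgebras.
Set Implicit Arguments.
Unset Strict Implicit.
Unset Printing Implicit Defensive.
Import Order.Theory.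
Local Open Scope order_scope.

(** * Homomorphisms and generated subalgebras *)

Section Homs.
Context {d d' : Order.disp_t}.
Context {D : ctbDistrLatticeType d} {C : ctbDistrLatticeType d'}.

Lemma hom_on_sub (S T : set D) (f : D -> C) : S `<=` T -> hom_on T f -> hom_on S f.
Proof.
move=> ST [f0 f1 fC fI fU]; split=> // [x /ST|x y /ST xT /ST yT|x y /ST xT /ST yT].
- exact: fC.
- exact: fI.
- exact: fU.
Qed.

Lemma hom_onW (S : set D) (f : D -> C) : hom f -> hom_on S f.
Proof. exact: hom_on_sub. Qed.

Lemma hom_meet (f : D -> C) :
  f \top = \top -> (forall x, f (~` x) = ~` f x) ->
  (forall x y, f (x `&` y) = f x `&` f y) -> hom f.
Proof.
move=> f1 fC fI; split=> // [|x y _ _]; first by rewrite -compl1 fC f1 compl1.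
by rewrite -[x `|` y]complK complU fC fI !fC complI !complK.
Qed.

Lemma subalg_closed_generated (S : set D) : subalg_closed (generated S).
Proof.
split=> [T [] [] //|T [] [] //|x Sx T TP|x y Sx Sy T TP|x y Sx Sy T TP].
- by have [[_ _ + _ _] _] := TP; apply; exact: Sx.
- by have [[_ _ _ + _] _] := TP; apply; [exact: Sx|exact: Sy].
- by have [[_ _ _ _ +] _] := TP; apply; [exact: Sx|exact: Sy].
Qed.

Lemma hom_eq_on_generated (S : set D) (f g : D -> C) : hom f -> hom g ->
  (forall x, S x -> f x = g x) -> forall x, generated S x -> f x = g x.
Proof.
move=> [f0 f1 fC fI fU] [g0 g1 gC gI gU] fg.
suff sub : generated S `<=` [set x | f x = g x] by move=> x /sub.
apply: smallest_sub => //; split; rewrite /= ?f0 ?f1 //.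
- by move=> y e; rewrite fC // gC // e.
- by move=> y z ey ez; rewrite fI // gI // ey ez.
- by move=> y z ey ez; rewrite fU // gU // ey ez.
Qed.

End Homs.

Lemma hom_comp (d1 d2 d3 : Order.disp_t) (D1 : ctbDistrLatticeType d1)
    (D2 : ctbDistrLatticeType d2) (D3 : ctbDistrLatticeType d3)
    (g : D2 -> D3) (f : D1 -> D2) : hom g -> hom f -> hom (fun x => g (f x)).
Proof.
move=> [g0 g1 gC gI gU] [f0 f1 fC fI fU].
by split=> *; rewrite ?f0 ?f1 ?fC ?fI ?fU ?gC ?gI ?gU.
Qed.

(** * Ultrafilters, taken as homomorphisms to [bool] *)

Section Ultrafilters.
Context {d : Order.disp_t} {D : ctbDistrLatticeType d}.

Let proper_filter (G : set D) := [/\ G \top, ~ G \bot,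
  forall x y, G x -> G y -> G (x `&` y) & forall x y, G x -> x <= y -> G y].

(** The ultrafilter theorem: Zorn's lemma gives a maximal proper filter containing [F], and
    maximality makes it decide every element. *)
Lemma hom_bool_extend (F : set D) : F \top -> ~ F \bot ->
  (forall x y, F x -> F y -> F (x `&` y)) ->
  exists psi : D -> bool, hom psi /\ forall x, F x -> psi x.
Proof.
move=> F1 F0 FI.
(* For [G] meet-closed and containing [\top], this is the filter generated by [G] and [x]. *)
pose up (G : set D) (x : D) := [set y | exists2 g, G g & g `&` x <= y].
have upP G x : G \top -> (forall x y, G x -> G y -> G (x `&` y)) ->
    (forall g, G g -> g `&` x != \bot) -> proper_filter (up G x).
  move=> G1 GI Gx; split=> [|[g Gg]|y z [g Gg gy] [h Gh hz]|y z [g Gg gy] yz].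
  - by exists \top; rewrite // lex1.
  - by rewrite lex0 (negbTE (Gx _ Gg)).
  - exists (g `&` h); first exact: GI.
    by rewrite -[x]meetxx meetACA leI2.
  - by exists g => //; exact: le_trans yz.
have FP : proper_filter (up F \top).
  apply: upP => // g Fg; rewrite meetx1; apply/eqP => g0; apply: F0.
  by rewrite -g0.
have Fup : F `<=` up F \top by move=> x Fx; exists x; rewrite // meetx1.
(* Admitting the empty set gives the empty chain a union in the family; a maximal [G] cannot be
   empty, since [up F \top] is larger. *)
have [Fs FsP totF|G [GP Gmax]] := @Zorn_bigcup D
    [set G | G = set0 \/ F `<=` G /\ proper_filter G].
  have [[G0 [FG0 [x G0x]]]|ne] := pselect (exists G, Fs G /\ G !=set0); last first.
    left; rewrite -subset0 => x [G FG Gx]; apply: ne; exists G; split => //.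
    by exists x.
  have FsP' G x' : Fs G -> G x' -> F `<=` G /\ proper_filter G.
    by move=> /FsP[->|].
  right; split.
    by move=> y Fy; exists G0 => //; have [+ _] := FsP' _ _ FG0 G0x; apply.
  split.
  - by exists G0 => //; have [_ []] := FsP' _ _ FG0 G0x.
  - by move=> [G FG G_0]; have [_ []] := FsP' _ _ FG G_0.
  - move=> y z [G FG Gy] [H FH Hz].
    have [_ [_ _ GI _]] := FsP' _ _ FG Gy; have [_ [_ _ HI _]] := FsP' _ _ FH Hz.
    have [GH|HG] := totF _ _ FG FH.
    + by exists H => //; apply: HI => //; exact: GH.
    + by exists G => //; apply: GI => //; exact: HG.
  - move=> y z [G FG Gy] yz; exists G => //.
    by have [_ [_ _ _]] := FsP' _ _ FG Gy; apply; first exact: Gy.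
case: GP => [G0|[FG [G1 G_0 GI GU]]].
  case: (Gmax (up F \top)); last by right.
  by rewrite G0; split; [exact: sub0set|move=> /(_ \top); apply; apply: Fup].
exists (fun x => `[< G x >]); split; last by move=> x Fx; apply/asboolP/FG.
apply: hom_meet => [|x|x y]; first exact/asboolP.
  rewrite complEbool; apply/idP/idP => [/asboolP GCx|].
    by apply/asboolP => Gx; apply: G_0; rewrite -(meetxC x); exact: GI.
  move=> /asboolP nGx; apply/asboolP.
  (* Either an element of [G] is disjoint from [x], hence below its complement, or [up G x] is
     proper and maximality puts [x] in [G], against [nGx]. *)
  have [[g [Gg gx]]|ne] := pselect (exists g, G g /\ g `&` x = \bot).
    by apply: (GU g) => //; rewrite -disj_leC gx.
  case: (Gmax (up G x)).
    split=> [y Gy|sub]; first by exists y => //; exact: leIl.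
    by apply: nGx; apply: sub; exists \top; rewrite // meet1x.
  right; split; first by move=> y /FG Gy; exists y => //; exact: leIl.
  by apply: upP => // g Gg; apply/eqP => gx; apply: ne; exists g.
apply/asboolP/andP => [Gxy|[/asboolP Gx /asboolP Gy]]; last exact: GI.
by split; apply/asboolP; apply: GU Gxy _; [exact: leIl|exact: leIr].
Qed.

Lemma hom_bool_separate (E : set D) (b : D) : subalg_closed E -> ~ E b ->
  exists psi1 psi2 : D -> bool, [/\ hom psi1, hom psi2,
    forall e, E e -> psi1 e = psi2 e, psi1 b & ~~ psi2 b].
Proof.
move=> [E0 E1 EC EI EU] nEb.
(* An ultrafilter avoiding the ideal of [E] generated by the elements below [b] or
   below [~` b], once restricted to [E], is consistent with both [b] and [~` b]. *)
pose F := [set x | exists e1 e2, [/\ E e1, E e2, e1 <= b, e2 <= ~` b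
  & x = ~` (e1 `|` e2)]].
have [|||psi [psi_hom psiF]] := hom_bool_extend (F := F).
- by exists \bot, \bot; rewrite !le0x joinxx compl0.
- move=> [e1 [e2 [Ee1 Ee2 e1b e2b /esym e0]]]; apply: nEb.
  suff <- : e1 = b by [].
  have e12 : e1 `|` e2 = \top by rewrite -[LHS]complK e0 compl0.
  rewrite -[RHS]meetx1 -e12 meetUr (meet_idPr e1b).
  suff /eqP -> : b `&` e2 == \bot by rewrite joinx0.
  by rewrite meetC disj_leC.
- move=> x y [e1 [e2 [Ee1 Ee2 e1b e2b ->]]] [f1 [f2 [Ef1 Ef2 f1b f2b ->]]].
  exists (e1 `|` f1), (e2 `|` f2); rewrite -complU joinACA !leUx e1b f1b e2b f2b.
  by split=> //; exact: EU.
case: (psi_hom) => psi0 psi1 psiC psiI psiU.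
(* The trace of [psi] on [E] extends to an ultrafilter containing [c] once none of its members is
   disjoint from [c]. It is applied to [b] and to its complement. *)
have ext c : (forall e, E e -> e <= ~` c -> ~~ psi e) -> exists phi : D -> bool,
    [/\ hom phi, forall e, E e -> psi e = phi e & phi c].
  move=> Ec; pose H := [set x | exists e, [/\ E e, psi e &
    x = e \/ x = e `&` c]].
  have [|||phi [phi_hom phiH]] := hom_bool_extend (F := H).
  - by exists \top; rewrite psi1; split=> //; left.
  - move=> [e [Ee pe [e0|/esym/eqP]]]; first by move: pe; rewrite -e0 psi0.
    by rewrite disj_leC => /(Ec _ Ee); rewrite pe.
  - move=> x y [e [Ee pe ex]] [f [Ef pf fy]]; exists (e `&` f).
    rewrite psiI // pe pf; split=> //; first exact: EI.
    case: ex fy => -> [] ->; [by left|right..].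
    + by rewrite meetA.
    + by rewrite meetAC.
    + by rewrite meetACA meetxx.
  case: (phi_hom) => phi0 phi1 phiC phiI phiU.
  have phiE e : E e -> psi e -> phi e.
    by move=> Ee pe; apply: phiH; exists e; split=> //; left.
  exists phi; split=> //; last first.
    by apply: phiH; exists \top; rewrite psi1 meet1x; split=> //; right.
  move=> e Ee; apply/idP/idP; first exact: phiE.
  apply: contraTT => npe.
  have /(phiE _ (EC _ Ee)) : psi (~` e) by rewrite psiC.
  by rewrite phiC.
have psi_compl x : psi (~` x) = ~~ psi x by rewrite psiC.
have notF e1 e2 : E e1 -> E e2 -> e1 <= b -> e2 <= ~` b -> ~~ psi (e1 `|` e2).
  by move=> *; rewrite -psi_compl; apply: psiF; exists e1, e2.
have [|phi1 [phi1_hom phi1E phi1b]] := ext b.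
  by move=> e Ee eb; rewrite -[e]join0x notF ?le0x.
have [|phi2 [phi2_hom phi2E phi2b]] := ext (~` b).
  by move=> e Ee; rewrite complK => eb; rewrite -[e]joinx0 notF ?le0x.
exists phi1, phi2; split=> //.
  by move=> e Ee; rewrite -phi1E // phi2E.
by case: (phi2_hom) phi2b => _ _ ->.
Qed.

(** There are enough ultrafilters: if [a] is not below [b], one of them contains [a] but not [b]. *)
Lemma hom_bool_eq (x y : D) :
  (forall psi : D -> bool, hom psi -> psi x = psi y) -> x = y.
Proof.
suff le a b : (forall psi : D -> bool, hom psi -> psi a = psi b) -> a <= b.
  by move=> xy; apply/le_anti/andP; split; apply: le => // psi /xy.
move=> ab; apply: contrapT => /negP nab.
pose F := [set z | a `&` ~` b <= z].
have [|||psi [psi_hom psiF]] := hom_bool_extend (F := F).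
- exact: lex1.
- by rewrite /F /= lex0 disj_leC complK (negbTE nab).
- by move=> u v; rewrite /F /= lexI => -> ->.
have := psiF a (leIl _ _); rewrite ab // => pb.
have := psiF (~` b) (leIr _ _).
by case: psi_hom => _ _ -> // _ _; rewrite pb.
Qed.

End Ultrafilters.

(** Turns compatible values on elements of several algebras into one total map. The default off the
    range matters where points are glued and where elements are renamed. *)
Lemma factor_through (X U Y : Type) (v : X -> U) (h : X -> Y) (dflt : U -> Y) :
  (forall x y, v x = v y -> h x = h y) ->
  exists g : U -> Y, (forall x, g (v x) = h x) /\
    forall u, ~ range v u -> g u = dflt u.
Proof.
move=> vh; have /choice[g gP] : forall u, exists y,
    (forall x, v x = u -> y = h x) /\ (~ range v u -> y = dflt u).
  move=> u; have [[x _ <-]|nu] := pselect (range v u).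
    exists (h x); split=> [y /esym/vh //|]; case; by exists x.
  by exists (dflt u); split=> // x xu; case: nu; exists x.
exists g; split=> [x|u]; last by case: (gP u).
by case: (gP (v x)) => + _; apply.
Qed.

(** * Points of a family and a dual criterion for pushouts *)

Section Pushouts.
Context {U : Type} {m : nat}.
Variable A : 'I_m -> balg U.

(* Only the values of [f] on the union of the [A i] are constrained, so distinct
   maps may represent the same point of the Stone space. *)
Definition is_point (f : U -> bool) := forall i, hom (fun x : A i => f (ba_val x)).

Lemma set1_neq0 (i : 'I_m) : [set i]%SET != finset.set0.
Proof. by apply/set0Pn; exists i; rewrite finset.in_set1. Qed.

(** Dual view of a cocone: each ultrafilter of its target pulls back to a point. *)
Lemma cocone_point (d : Order.disp_t) (C : ctbDistrLatticeType d)
    (g : {set 'I_m} -> U -> C) (phi : C -> bool) : cocone A g -> hom phi ->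
  exists2 f, is_point f &
    forall i (x : A i), f (ba_val x) = phi (g [set i]%SET (ba_val x)).
Proof.
move=> [ghom geq] phi_hom.
have [|f [fE _]] := @factor_through {i : 'I_m & A i} U bool
    (fun p => ba_val (projT2 p))
    (fun p => phi (g [set projT1 p]%SET (ba_val (projT2 p)))) (fun=> true).
  move=> [i x] [k y] /= xy.
  (* On a common element, the components at [i] and at [k] both agree with the one at the pair. *)
  have cxy : common A [set i; k]%SET (ba_val x).
    move=> l; rewrite !inE => /orP[] /eqP ->; first by exists x.
    by exists y.
  rewrite -xy -(geq _ _ (set1_neq0 i) _ _ cxy); last by rewrite finset.sub1set !inE eqxx.
  by rewrite -(geq _ _ (set1_neq0 k) _ _ cxy) // finset.sub1set !inE eqxx orbT.
have fE' i (x : A i) : f (ba_val x) = phi (g [set i]%SET (ba_val x)).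
  by rewrite -(fE (existT _ i x)).
exists f => // i.
have -> : (fun x : A i => f (ba_val x)) = (fun x : A i => phi (g [set i]%SET (ba_val x))).
  exact/funext.
have gi : hom (fun x : A i => g [set i]%SET (ba_val x)).
  apply: hom_on_sub (ghom [set i]%SET i (set11 i)) => x _ k.
  by rewrite inE => /eqP ->; exists x.
exact: hom_comp phi_hom gi.
Qed.

(** Generation makes the mediating map unique. By the last premise ultrafilters of [P] induce all
    points, so a relation among generators that holds in [P] holds in every cocone. *)
Lemma pushout_of_points (d : Order.disp_t) (P : ctbDistrLatticeType d)
    (iota : forall i, A i -> P) :
  (forall i, hom (iota i)) ->
  (forall i k (x : A i) (y : A k), ba_val x = ba_val y -> iota i x = iota k y) ->
  (forall p, generated (\bigcup_i range (iota i)) p) ->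
  (forall f, is_point f -> exists psi : P -> bool, hom psi /\
     forall i (x : A i), psi (iota i x) = f (ba_val x)) ->
  pushout iota.
Proof.
move=> iota_hom iota_eq gen lift.
have [|l0 [l0E _]] := @factor_through {i : 'I_m & A i} U P
    (fun p => ba_val (projT2 p)) (fun p => iota _ (projT2 p)) (fun=> \bot).
  by move=> [i x] [k y]; exact: iota_eq.
have {}l0E i (x : A i) : l0 (ba_val x) = iota i x by rewrite -(l0E (existT _ i x)).
(* One map serves for all index sets, because every component of the cocone is a restriction of the
   coprojections. *)
exists (fun=> l0); split=> //; split.
  split=> // s i si; have -> : (fun x : A i => l0 (ba_val x)) = iota i by exact/funext.
  exact: hom_onW.
move=> d' C g gP.
(* [R] is the graph of the mediating map: it is functional because [C] has enough
   ultrafilters, and total because it is so on generators. *)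
pose R p c := forall (phi : C -> bool) (psi : P -> bool), hom phi -> hom psi ->
  (forall i (x : A i), psi (iota i x) = phi (g [set i]%SET (ba_val x))) ->
  psi p = phi c.
have R_fun p c c' : R p c -> R p c' -> c = c'.
  move=> pc pc'; apply: hom_bool_eq => phi phi_hom.
  have [f fpt fE] := cocone_point gP phi_hom.
  have [psi [psi_hom psiE]] := lift f fpt.
  have psiE' i (x : A i) : psi (iota i x) = phi (g [set i]%SET (ba_val x)).
    by rewrite psiE fE.
  by rewrite -(pc _ _ phi_hom psi_hom psiE') (pc' _ _ phi_hom psi_hom psiE').
have R0 : R \bot \bot by move=> phi psi [+ _ _ _ _] [+ _ _ _ _] => -> ->.
have R1 : R \top \top by move=> phi psi [_ + _ _ _] [_ + _ _ _] => -> ->.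
have RC p c : R p c -> R (~` p) (~` c).
  move=> pc phi psi phom qhom pq; have := pc _ _ phom qhom pq.
  by case: phom qhom => _ _ phiC _ _ [_ _ psiC _ _]; rewrite phiC // psiC // => ->.
have RI p c q e : R p c -> R q e -> R (p `&` q) (c `&` e).
  move=> pc qe phi psi phom qhom pq.
  have := pc _ _ phom qhom pq; have := qe _ _ phom qhom pq.
  by case: phom qhom => _ _ _ phiI _ [_ _ _ psiI _]; rewrite phiI // psiI // => -> ->.
have RU p c q e : R p c -> R q e -> R (p `|` q) (c `|` e).
  move=> pc qe phi psi phom qhom pq.
  have := pc _ _ phom qhom pq; have := qe _ _ phom qhom pq.
  by case: phom qhom => _ _ _ _ phiU [_ _ _ _ psiU]; rewrite phiU // psiU // => -> ->.
have Riota i (x : A i) : R (iota i x) (g [set i]%SET (ba_val x)).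
  by move=> phi psi _ _ ->.
have /choice[h hR] : forall p, exists c, R p c.
  suff sub : generated (\bigcup_i range (iota i)) `<=` [set p | exists c, R p c].
    by move=> p; exact: (sub _ (gen p)).
  apply: smallest_sub; last by move=> _ [i _ [x _ <-]]; exists (g [set i]%SET (ba_val x)).
  split.
  - by exists \bot.
  - by exists \top.
  - by move=> p [c /RC]; exists (~` c).
  - by move=> p q [c pc] [e qe]; exists (c `&` e); exact: RI.
  - by move=> p q [c pc] [e qe]; exists (c `|` e); exact: RU.
exists h; split; first split.
- split=> *; apply: R_fun (hR _) _ => //; [exact: RC|exact: RI|exact: RU].
- move=> s s0 u us; have /set0Pn[i si] := s0.
  have [x _ xu] := us i si; rewrite -xu l0E (R_fun _ _ _ (hR _) (Riota _ _)).
  case: gP => _ geq; apply/esym/geq; rewrite ?set1_neq0 ?finset.sub1set //.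
  by rewrite xu.
- move=> h' [h'_hom h'E]; apply/funext => p.
  apply: hom_eq_on_generated (gen p) => //.
    split=> *; apply: R_fun (hR _) _ => //; [exact: RC|exact: RI|exact: RU].
  move=> _ [i _ [x _ <-]].
  rewrite (R_fun _ _ _ (hR _) (Riota _ _)) -h'E ?set1_neq0 ?l0E //.
  by move=> k; rewrite inE => /eqP ->; exists x.
Qed.

End Pushouts.

(** * Subalgebras as algebras in their own right *)

Section Subalgebras.
Context {d : Order.disp_t} {D : ctbDistrLatticeType d}.

Lemma hom_val (C : subalg D) : hom (val : subalg_type C -> D).
Proof. by []. Qed.

Definition subalg_elt (C : subalg D) x (Cx : subalg_set C x) : subalg_type C :=
  exist _ x (mem_set Cx).

Lemma subalg_eltP (C : subalg D) (p : subalg_type C) : subalg_set C (val p).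
Proof. exact/set_mem/(valP p). Qed.

Lemma generated_subalg (S : set D) (C : subalg D) (p : subalg_type C) :
  generated S `<=` C -> generated S (val p) ->
  generated [set q : subalg_type C | S (val q)] p.
Proof.
set T := [set q : subalg_type C | _] => SC.
have [T0 T1 TC TI TU] := subalg_closed_generated T.
suff sub : generated S `<=` val @` generated T by move=> /sub[q Tq /val_inj <-].
apply: smallest_sub; last first.
  move=> x Sx; have Cx : subalg_set C x by apply: SC; exact: sub_gen_smallest.
  by exists (subalg_elt Cx) => //; exact: sub_gen_smallest.
split.
- by exists \bot.
- by exists \top.
- by move=> _ [q Tq <-]; exists (~` q) => //; exact: TC.
- by move=> _ _ [q Tq <-] [r Tr <-]; exists (q `&` r) => //; exact: TI.
- by move=> _ _ [q Tq <-] [r Tr <-]; exists (q `|` r) => //; exact: TU.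
Qed.

End Subalgebras.

(** * Algebras of clopen sets of points *)

Section Clopens.
Context {U : Type} {n : nat}.
Variable A : 'I_n -> balg U.

Definition points := {f : U -> bool | is_point A f}.

Definition clopen i (x : A i) : set points := [set k : points | sval k (ba_val x)].

Lemma hom_clopen i : hom (@clopen i).
Proof.
apply: hom_meet => [|x|x y]; apply/seteqP; split=> -[f fpt];
  case: (fpt i) => _ f1 fC fI _; rewrite /clopen /= ?f1 ?fC ?fI //.
- by move=> /negP.
- by move=> /negP.
- by move=> /andP.
- by move=> /andP.
Qed.

(** The principal ultrafilter at [k]; through it, points act as ultrafilters on algebras of clopen
    sets. *)
Lemma hom_eval (T : Type) (k : T) : hom (fun X : set T => `[< X k >]).
Proof.
apply: hom_meet => [|X|X Y]; first exact/asboolP.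
  by rewrite complEbool -asbool_neg.
by rewrite -[RHS]asbool_and.
Qed.

Lemma clopen_eq i j (x : A i) (y : A j) : ba_val x = ba_val y -> clopen x = clopen y.
Proof. by rewrite /clopen => ->. Qed.

Lemma asbool_clopen i (x : A i) f (fpt : is_point A f) :
  `[< clopen x (exist _ f fpt) >] = f (ba_val x).
Proof. by apply/asboolP/idP. Qed.

Section IndexedSubalgebra.
Context {k : nat}.
Variable w : 'I_k -> 'I_n.

(** [w] selects a subfamily, but the points remain those of the whole family, so that all these
    algebras lie in one power set. *)
Definition clopen_alg : subalg (set points) :=
  Subalg (subalg_closed_generated (\bigcup_i range (@clopen (w i)))).

Fact clopen_algP i (x : A (w i)) : subalg_set clopen_alg (clopen x).
Proof. by apply: sub_gen_smallest; exists i => //; exists x. Qed.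

Definition clopen_map i (x : A (w i)) : subalg_type clopen_alg :=
  subalg_elt (clopen_algP x).

Lemma hom_clopen_map i : hom (@clopen_map i).
Proof.
have [c0 c1 cC cI cU] := hom_clopen (w i).
by split=> *; apply: val_inj; rewrite /= ?c0 ?c1 ?cC ?cI ?cU.
Qed.

Lemma clopen_map_eq i l (x : A (w i)) (y : A (w l)) :
  ba_val x = ba_val y -> clopen_map x = clopen_map y.
Proof. by move=> xy; apply: val_inj; exact: clopen_eq. Qed.

Lemma clopen_map_generate p : generated (\bigcup_i range (@clopen_map i)) p.
Proof.
have := @generated_subalg _ _ _ clopen_alg p (@subset_refl _ _) (subalg_eltP p).
apply: sub_smallest2r; first exact: subalg_closed_generated.
move=> q [i _ [x _ xq]]; exists i => //; exists x => //.
exact: val_inj.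
Qed.

Section Pushout.
Hypothesis extend : forall f, is_point (fun i => A (w i)) f ->
  exists2 f', is_point A f' & forall i (x : A (w i)), f' (ba_val x) = f (ba_val x).

(** The ultrafilter is evaluation at an extension of [f]; one is needed because the clopen sets
    consist of points of the whole family. *)
Lemma clopen_map_lift f : is_point (fun i => A (w i)) f ->
  exists psi : subalg_type clopen_alg -> bool, hom psi /\
    forall i (x : A (w i)), psi (clopen_map x) = f (ba_val x).
Proof.
move=> /extend[f' fpt ff']; exists (fun p => `[< val p (exist _ f' fpt) >]); split.
  exact: hom_comp (hom_eval _) (hom_val clopen_alg).
by move=> i x; rewrite asbool_clopen ff'.
Qed.

Lemma pushout_clopen : pushout (A := fun i => A (w i)) clopen_map.
Proof.
apply: pushout_of_points.
- exact: hom_clopen_map.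
- exact: clopen_map_eq.
- exact: clopen_map_generate.
- exact: clopen_map_lift.
Qed.

(** A point of the relabelled family becomes a point of the original one by composition with [j]. *)
Lemma pushout_clopen_balg_map (V : Type) (j : U -> V) (jI : injective j) :
  pushout (A := fun i => balg_map jI (A (w i))) clopen_map.
Proof.
apply: (@pushout_of_points _ _ (fun i => balg_map jI (A (w i)))).
- exact: hom_clopen_map.
- by move=> i l x y /jI; exact: clopen_map_eq.
- exact: clopen_map_generate.
- by move=> f fpt; exact: (clopen_map_lift (f := fun u => f (j u))).
Qed.

End Pushout.
End IndexedSubalgebra.
End Clopens.

(** Makes [commute_in] usable: it quantifies over all pushouts and would say nothing without one. *)
Lemma pushout_exists (U : Type) (m : nat) (A : 'I_m -> balg U) :
  exists (d : Order.disp_t) (P : ctbDistrLatticeType d) (iota : forall i, A i -> P),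
    pushout iota.
Proof.
exists _, _, (@clopen_map _ _ A _ id).
by apply: pushout_clopen => f fpt; exists f.
Qed.

(** Ultrafilters on the subalgebras, compatible as restrictions of one [f], induce an ultrafilter
    [xi] of their pushout; since the pushout embeds in [D], this extends to [D]. *)
Lemma commute_in_extend (d : Order.disp_t) (D : ctbDistrLatticeType d) (k : nat)
    (S : 'I_k -> set D) (f : D -> bool) :
  commute_in D S -> (forall i, hom_on (S i) f) ->
  exists psi : D -> bool, hom psi /\ forall i x, S i x -> psi x = f x.
Proof.
move=> [C [CS inj]] fS.
have [d' [P [iota iotaP]]] := pushout_exists (fun i => balg_of_subalg (C i)).
have [l [[lP univ] lE]] := iotaP.
have [|h [[h_hom hE] _]] := univ _ D (fun _ u => u).
  by split=> // s i _; exact: hom_onW (hom_val (C i)).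
have [|xi [[xi_hom xiE] _]] := univ _ bool (fun _ => f).
  split=> // s i _; suff fhom : hom (fun x : subalg_type (C i) => f (val x)).
    exact (@hom_onW _ _ _ _ _ _ fhom).
  have Sval (x : subalg_type (C i)) : S i (val x) by rewrite -CS; exact: subalg_eltP.
  by case: (fS i) => f0 f1 fC fI fU; split=> [//|//|x _|x y _ _|x y _ _];
    [exact: fC|exact: fI|exact: fU].
have in_common i (x : balg_of_subalg (C i)) :
    common (fun i => balg_of_subalg (C i)) [set i]%SET (ba_val x).
  by move=> j; rewrite finset.in_set1 => /eqP ->; exists x.
have {}hE i (x : balg_of_subalg (C i)) : h (iota i x) = val x.
  by rewrite -lE hE ?set1_neq0.
have {}xiE i (x : balg_of_subalg (C i)) : xi (iota i x) = f (val x).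
  by rewrite -lE xiE ?set1_neq0.
have h_inj : injective h by exact: inj iotaP h h_hom hE.
case: h_hom xi_hom => h0 h1 hC hI hU [xi0 xi1 xiC xiI xiU].
(* Injectivity of [h] keeps [\bot] out of the image of the ultrafilter [xi]. *)
have [|||psi [psi_hom psiE]] := hom_bool_extend (F := [set h p | p in [set p | xi p]]).
- by exists \top; rewrite //= xi1.
- by move=> [p /= xip]; rewrite -h0 => /h_inj p0; rewrite p0 xi0 in xip.
- move=> _ _ [p xip <-] [q xiq <-]; exists (p `&` q); last exact: hI.
  by rewrite /= xiI // xip xiq.
have psi_h p : psi (h p) = xi p.
  apply/idP/idP => [|xip]; last by apply: psiE; exists p.
  apply: contraTT => nxip; have : psi (h (~` p)).
    by apply: psiE; exists (~` p) => //=; rewrite xiC.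
  by rewrite hC //; case: psi_hom => _ _ -> //.
exists psi; split=> // i x; rewrite -CS => Cx.
by have := xiE i (subalg_elt Cx); rewrite -psi_h hE.
Qed.

(** Both algebras carry the operations of [D], relabelled by the same injection. *)
Lemma overlap_of_homs (V : Type) (d : Order.disp_t) (D : ctbDistrLatticeType d)
    (w : D -> V) (A B : balg V) (f : A -> D) (g : B -> D) :
  injective w -> hom f -> hom g -> (forall x, ba_val x = w (f x)) ->
  (forall y, ba_val y = w (g y)) -> overlap A B.
Proof.
move=> wI [f0 f1 fC fI fU] [g0 g1 gC gI gU] Af Bg.
split=> [||x x'|x y x' y'|x y x' y']; rewrite !Af !Bg.
- by rewrite f0 g0.
- by rewrite f1 g1.
- by move=> /wI e; rewrite fC // gC // e.
- by move=> /wI e /wI e'; rewrite fI // gI // e e'.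
- by move=> /wI e /wI e'; rewrite fU // gU // e e'.
Qed.

Lemma hom_on_overlap (U : Type) (A B : balg U) (f : U -> bool) : overlap A B ->
  hom (fun x : A => f (ba_val x)) ->
  hom_on [set y : B | elts A (ba_val y)] (fun y => f (ba_val y)).
Proof.
move=> [e0 e1 eC eI eU] [f0 f1 fC fI fU].
split=> [||y [x _ xy]|y y' [x _ xy] [x' _ xy']|y y' [x _ xy] [x' _ xy']].
- by rewrite -e0.
- by rewrite -e1.
- by rewrite -(eC _ _ xy) fC // xy.
- by rewrite -(eI _ _ _ _ xy xy') fI // xy xy'.
- by rewrite -(eU _ _ _ _ xy xy') fU // xy xy'.
Qed.

Lemma hom_on_image (d1 d2 d3 : Order.disp_t) (D1 : ctbDistrLatticeType d1)
    (D2 : ctbDistrLatticeType d2) (D3 : ctbDistrLatticeType d3)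
    (S : set D1) (f : D1 -> D2) (g : D2 -> D3) :
  hom f -> hom_on S (fun x => g (f x)) -> hom_on (f @` S) g.
Proof.
move=> [f0 f1 fC fI fU] [g0 g1 gC gI gU].
split=> [||_ [x Sx <-]|_ _ [x Sx <-] [y Sy <-]|_ _ [x Sx <-] [y Sy <-]].
- by rewrite -f0.
- by rewrite -f1.
- by rewrite -fC // gC.
- by rewrite -fI // gI.
- by rewrite -fU // gU.
Qed.

(** * Extending points along the family, one algebra at a time *)

Section Tower.
Context {U : Type} {n : nat}.
Variable A : 'I_n -> balg U.
Hypothesis A_overlap : forall i j : 'I_n, overlap (A i) (A j).
Hypothesis A_commute : forall m : 'I_n,
  commute_in (A m) (fun i : 'I_m => [set x : A m |
    elts (initial A (ltnW (ltn_ord m)) i) (ba_val x)]).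

Let is_point_lt m (f : U -> bool) :=
  forall i : 'I_n, (i < m)%N -> hom (fun x : A i => f (ba_val x)).

Lemma is_point_initial m (le_mn : (m <= n)%N) f :
  is_point (initial A le_mn) f -> is_point_lt m f.
Proof.
move=> fpt i im; have <- : widen_ord le_mn (Ordinal im) = i by exact: val_inj.
exact: fpt.
Qed.

(** [f'] follows [g] on [A m] and defaults to [f] elsewhere. *)
Lemma point_glue (m : 'I_n) (f : U -> bool) (g : A m -> bool) :
  is_point_lt m f -> hom g ->
  (forall (i : 'I_n) (x : A i) (y : A m), (i < m)%N -> ba_val x = ba_val y ->
    f (ba_val x) = g y) ->
  exists f', [/\ is_point_lt m.+1 f',
    forall (i : 'I_n) (x : A i), (i < m)%N -> f' (ba_val x) = f (ba_val x) &
    forall y : A m, f' (ba_val y) = g y].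
Proof.
move=> fpt ghom fg.
have [|f' [f'g f'f]] := @factor_through _ _ _ (@ba_val U (A m)) g f.
  by move=> x y /ba_inj ->.
have f'E (i : 'I_n) (x : A i) : (i < m)%N -> f' (ba_val x) = f (ba_val x).
  move=> im; have [[y _ yx]|] := pselect (range (@ba_val U (A m)) (ba_val x));
    last exact: f'f.
  by rewrite -yx f'g; apply/esym; rewrite yx; exact: fg.
exists f'; split=> // i; rewrite ltnS leq_eqVlt => /orP[/eqP im|im].
  have -> : i = m by exact: val_inj.
  by have -> : (fun x : A m => f' (ba_val x)) = g by exact/funext.
have -> : (fun x : A i => f' (ba_val x)) = (fun x : A i => f (ba_val x)).
  by apply/funext => x; exact: f'E.
exact: fpt.
Qed.

(** By overlap, [f] is a homomorphism on each trace of [A i] in [A m]; these traces commute, so [f]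
    on them extends to all of [A m]. *)
Lemma point_restrict (m : 'I_n) (f : U -> bool) : is_point_lt m f ->
  exists2 g : A m -> bool, hom g & forall (i : 'I_n) (x : A i) (y : A m),
    (i < m)%N -> ba_val x = ba_val y -> f (ba_val x) = g y.
Proof.
move=> fpt; have [|g [ghom gE]] :=
    @commute_in_extend _ _ _ _ (fun y : A m => f (ba_val y)) (A_commute m).
  by move=> i; apply: hom_on_overlap; [exact: A_overlap|exact/fpt/(ltn_ord i)].
exists g => // i x y im.
have e : widen_ord (ltnW (ltn_ord m)) (Ordinal im) = i by exact: val_inj.
move: x; rewrite -e => x xy; by rewrite xy (gE (Ordinal im)) //=; exists x.
Qed.

Lemma point_extend m (f : U -> bool) : (m <= n)%N -> is_point_lt m f ->
  exists2 f', is_point A f' &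
    forall (i : 'I_n) (x : A i), (i < m)%N -> f' (ba_val x) = f (ba_val x).
Proof.
(* Induction on the number of algebras still to be added. *)
move: {2}(n - m)%N (erefl (n - m)%N) => k.
elim: k m f => [|k IH] m f nm le_mn fpt.
  exists f => // i; apply: fpt; apply: leq_trans (ltn_ord i) _.
  by rewrite -subn_eq0 nm.
have lt_mn : (m < n)%N by rewrite -subn_gt0 nm.
have [g ghom fg] := point_restrict (m := Ordinal lt_mn) fpt.
have [f' [f'pt f'f _]] := point_glue (m := Ordinal lt_mn) fpt ghom fg.
have [|f'' f''pt f''f'] := IH m.+1 f' _ lt_mn f'pt; first by rewrite subnS nm.
by exists f'' => // i x im; rewrite f''f' ?f'f // ltnW.
Qed.

Lemma point_initial_extend m (le_mn : (m <= n)%N) f :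
  is_point (initial A le_mn) f ->
  exists2 f', is_point A f' &
    forall i (x : initial A le_mn i), f' (ba_val x) = f (ba_val x).
Proof.
move=> /is_point_initial /(point_extend le_mn)[f' f'pt f'f].
by exists f' => // i x; apply: f'f; exact: (ltn_ord i).
Qed.

(** * Clopen sets determine elements: the step that adds [A m] *)

Section Injectivity.
Variable m : 'I_n.
Let w := widen_ord (ltnW (ltn_ord m)).
Hypothesis A_reflect :
  commutatively_reflects (elts (A m)) (initial A (ltnW (ltn_ord m))).
Hypothesis clopen_inj_lt : forall (i k : 'I_m) (x : A (w i)) (y : A (w k)),
  clopen x = clopen y -> ba_val x = ba_val y.

Let B := clopen_alg A w.
Let iota i (x : A (w i)) : subalg_type B := clopen_map x.

Let iota_inj (i k : 'I_m) (x : A (w i)) (y : A (w k)) :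
  iota x = iota y -> ba_val x = ba_val y.
Proof. by move=> xy; apply: clopen_inj_lt; exact: (congr1 val xy). Qed.

Let iota_pushout : pushout (A := initial A (ltnW (ltn_ord m))) iota.
Proof. by apply: pushout_clopen; exact: point_initial_extend. Qed.

Lemma hom_point_lt (phi : subalg_type B -> bool) : hom phi ->
  exists2 f, is_point_lt m f & forall i (x : A (w i)), f (ba_val x) = phi (iota x).
Proof.
move=> phi_hom.
have [|f [fE _]] := @factor_through {i & A (w i)} U bool
    (fun p => ba_val (projT2 p)) (fun p => phi (iota (projT2 p))) (fun=> true).
  by move=> [i x] [k y] /= xy; rewrite /iota (clopen_map_eq xy).
have {}fE i (x : A (w i)) : f (ba_val x) = phi (iota x) by rewrite -(fE (existT _ i x)).
exists f => //; apply: (is_point_initial (le_mn := ltnW (ltn_ord m))) => i.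
suff -> : (fun x : A (w i) => f (ba_val x)) = (fun x => phi (iota x)).
  exact: (hom_comp phi_hom (@hom_clopen_map _ _ A _ w i)).
exact/funext.
Qed.

(** The two ultrafilters glue to a point of the algebras up to [m], which then extends along the
    later ones. *)
Lemma joint_point (phi : subalg_type B -> bool) (psi : A m -> bool) :
  hom phi -> hom psi ->
  (forall i (x : A (w i)) (y : A m), ba_val x = ba_val y ->
    phi (iota x) = psi y) ->
  exists f, [/\ is_point A f,
    forall i (x : A (w i)), f (ba_val x) = phi (iota x) &
    forall y : A m, f (ba_val y) = psi y].
Proof.
move=> phi_hom psi_hom phipsi.
have [f fpt fE] := hom_point_lt phi_hom.
have [|f' [f'pt f'f f'psi]] := point_glue fpt psi_hom.
  move=> i x y im; have e : w (Ordinal im) = i by exact: val_inj.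
  by move: x; rewrite -e => x xy; rewrite fE; exact: phipsi.
have [f'' f''pt f''f'] := point_extend (ltn_ord m) f'pt.
exists f''; split=> // [i x|y]; last by rewrite f''f'.
have im : (w i < m)%N by exact: ltn_ord i.
by rewrite f''f' ?f'f ?fE // ltnW.
Qed.

Lemma clopen_inj_top (x y : A m) : clopen x = clopen y -> x = y.
Proof.
move=> xy; apply: hom_bool_eq => psi psi_hom.
(* [g] reads [psi] on [U], and [F] carries it over to [B], where it is well defined because [iota]
   is injective. Commutation in [B] then extends the traces to an ultrafilter [phi] compatible with
   [psi]. *)
have [|g [gE _]] := @factor_through _ _ _ (@ba_val U (A m)) psi (fun=> true).
  by move=> u v /ba_inj ->.
have [|F [FE _]] := @factor_through {i & A (w i)} _ bool
    (fun p => iota (projT2 p)) (fun p => g (ba_val (projT2 p))) (fun=> true).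
  by move=> [i u] [k v] /= /iota_inj ->.
have {}FE i (u : A (w i)) : F (iota u) = g (ba_val u) by rewrite -(FE (existT _ i u)).
have [_ /(_ _ _ _ iota_pushout)[comm _]] := A_reflect.
have [|phi [phi_hom phiE]] := commute_in_extend (f := F) comm.
  move=> i; apply: hom_on_image; first exact: hom_clopen_map.
  have -> : (fun u : A (w i) => F (iota u)) = (fun u => g (ba_val u)) by exact/funext.
  apply: hom_on_overlap; first exact: A_overlap.
  by have -> : (fun u : A m => g (ba_val u)) = psi by exact/funext.
have [|f [fpt _ fpsi]] := joint_point phi_hom psi_hom.
  move=> i u v uv; rewrite (phiE i) ?FE ?uv ?gE //.
  by exists u => //=; rewrite uv; exists v.
by rewrite -!fpsi -!(asbool_clopen _ fpt) xy.
Qed.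

Lemma clopen_inj_mixed (i : 'I_m) (x : A (w i)) (y : A m) :
  clopen x = clopen y -> ba_val x = ba_val y.
Proof.
move=> xy; have [_ /(_ _ _ _ iota_pushout)[_ inter]] := A_reflect.
pose E := generated (\bigcup_k (@iota k @` [set u | elts (A m) (ba_val u)])).
have Ex : E (iota x).
  apply: contrapT => nEx.
  have [phi1 [phi2 [phi1_hom phi2_hom phi12 phi1x phi2x]]] :=
    hom_bool_separate (subalg_closed_generated _) nEx.
  have [f fpt fE] := hom_point_lt phi1_hom.
  have [psi psi_hom fpsi] := point_restrict fpt.
  have phi1psi k (u : A (w k)) (v : A m) : ba_val u = ba_val v -> phi1 (iota u) = psi v.
    by move=> uv; rewrite -fE; apply: fpsi uv; exact: ltn_ord k.
  (* Since [phi1] and [phi2] agree on the trace of [A m], the same [psi] is compatible with both;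
     evaluating the common clopen set at [f1] and [f2] then gives both values of [phi1], [phi2] at
     [iota x] as [psi y]. *)
  have [f1 [f1pt f1E f1psi]] := joint_point phi1_hom psi_hom phi1psi.
  have [|f2 [f2pt f2E f2psi]] := joint_point phi2_hom psi_hom.
    move=> k u v uv; rewrite -phi12 ?(phi1psi _ _ _ uv) //.
    apply: sub_gen_smallest; exists k => //; exists u => //=.
    by rewrite uv; exists v.
  have := asbool_clopen y f1pt; have := asbool_clopen y f2pt.
  rewrite -xy !asbool_clopen f1E f1psi f2E f2psi => e2 e1.
  by move: phi2x; rewrite e2 -e1 phi1x.
(* The third clause of reflection puts [x] in [A m], as [y'], which reduces the claim to two
   elements of [A m]. *)
have [x' [y' _ y'x'] x'x] : (@iota i @` [set u | elts (A m) (ba_val u)]) (iota x).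
  by rewrite -[X in X _]inter; split => //; exists x.
have e : ba_val y' = ba_val x by rewrite y'x'; exact: iota_inj.
rewrite -e; congr ba_val; apply: clopen_inj_top.
by rewrite -xy; exact: clopen_eq.
Qed.

End Injectivity.

Hypothesis A_reflect : forall m : 'I_n,
  commutatively_reflects (elts (A m)) (initial A (ltnW (ltn_ord m))).

(** Induction on a bound for both indices: two, one or no elements taken from the newest algebra
    fall to [clopen_inj_top], [clopen_inj_mixed] and the induction hypothesis. *)
Lemma clopen_inj (i k : 'I_n) (x : A i) (y : A k) :
  clopen x = clopen y -> ba_val x = ba_val y.
Proof.
suff H m : (m <= n)%N -> forall (i k : 'I_n) (x : A i) (y : A k),
    (i < m)%N -> (k < m)%N -> clopen x = clopen y -> ba_val x = ba_val y.
  exact: (H n (leqnn n) _ _ _ _ (ltn_ord i) (ltn_ord k)).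
elim: m => // m IH lt_mn {}i {}k {}x {}y.
pose mo := Ordinal lt_mn; pose w := widen_ord (ltnW (ltn_ord mo)).
have {}IH (a b : 'I_mo) (u : A (w a)) (v : A (w b)) :
    clopen u = clopen v -> ba_val u = ba_val v.
  exact: (IH (ltnW lt_mn) (w a) (w b) u v (ltn_ord a) (ltn_ord b)).
have mixed := clopen_inj_mixed (A_reflect mo) IH.
have cases (l : 'I_n) : (l < m.+1)%N -> l = mo \/ exists a : 'I_mo, l = w a.
  rewrite ltnS leq_eqVlt => /orP[/eqP lm|lm]; first by left; exact: val_inj.
  by right; exists (Ordinal lm); exact: val_inj.
move=> /cases[ei|[a ei]] /cases[ek|[b ek]]; subst i k.
- by move=> /(clopen_inj_top (A_reflect mo) IH) ->.
- by move=> /esym/mixed.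
- exact: mixed.
- exact: IH.
Qed.

End Tower.
End BooleanAlgebras.

(** * Realising the pushouts over one ambient set *)

Theorem theorem3p53 (U : Type) (n : nat) (A : 'I_n -> balg U)
    (A_overlap : forall i j : 'I_n, overlap (A i) (A j))
    (A_reflect : forall m : 'I_n,
       commutatively_reflects (elts (A m)) (initial A (ltnW (ltn_ord m))))
    (A_commute : forall m : 'I_n,
       commute_in (A m) (fun i : 'I_m => [set x : A m |
         elts (initial A (ltnW (ltn_ord m)) i) (ba_val x)])) :
  exists (V : Type) (j : U -> V) (jI : injective j) (B : 'I_n.+1 -> balg V),
    let A' i := balg_map jI (A i) in
    [/\ forall m : 'I_n.+1,
          pushout_by_inclusions (initial A' (leq_ord m)) (B m),
        forall (i : 'I_n) (k : 'I_n.+1), (i < k)%N -> subalgebra (A' i) (B k) &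
        forall i k : 'I_n.+1, (i < k)%N -> subalgebra (B i) (B k)].
Proof.
(* The [A i] must be literal subsets of the [B m], so their elements are renamed to clopen sets; the
   summand [U] houses the elements lying in no [A i], which keeps [j] injective. *)
pose V := (set (points A) + U)%type.
have valI : forall (i k : 'I_n) (x : A i) (y : A k),
    clopen x = clopen y -> ba_val x = ba_val y.
  by move=> i k x y; exact: clopen_inj.
have inlI : injective (@inl (set (points A)) U) by move=> X Y [].
have [|j [jE jU]] := @factor_through {i & A i} U V
    (fun p => ba_val (projT2 p)) (fun p => inl (clopen (projT2 p))) inr.
  by move=> [i x] [k y] /= xy; rewrite (clopen_eq xy).
have {}jE i (x : A i) : j (ba_val x) = inl (clopen x) by rewrite -(jE (existT _ i x)).
have jI : injective j.
  have jP u : (exists i (x : A i), u = ba_val x) \/ j u = inr u.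
    have [[[i x] _ <-]|/jU] := pselect (range (fun p : {i & A i} => ba_val (projT2 p)) u).
      by left; exists i, x.
    by right.
  move=> u v; have [[i [x ->]]|->] := jP u; have [[k [y ->]]|->] := jP v; rewrite ?jE //.
  - by move=> [] /valI.
  - by move=> [].
exists V, j, jI.
(* Every [C k] lies in the same power set, so passing to more generators gives genuine
   inclusions. *)
pose C (k : 'I_n.+1) := clopen_alg A (widen_ord (leq_ord k)).
pose B k := balg_map inlI (balg_of_subalg (C k)); exists B.
move=> A'; split.
- move=> m; exists (@clopen_map _ _ A _ (widen_ord (leq_ord m))); split.
    by move=> i x; rewrite /= jE.
  by apply: pushout_clopen_balg_map => f; exact: point_initial_extend.
- move=> i k ik; split.
    move=> _ [x _ <-].
    have e : widen_ord (leq_ord k) (Ordinal ik) = i by exact: val_inj.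
    move: x; rewrite -e => x.
    exists (@clopen_map _ _ A _ (widen_ord (leq_ord k)) (Ordinal ik) x) => //.
    exact/esym/jE.
  apply: (@overlap_of_homs _ _ _ _ (A' i) (B k) (@clopen _ _ A i) val inlI) => //.
    exact: hom_clopen.
  exact: jE.
- move=> i k ik; split; last first.
    exact: (@overlap_of_homs _ _ _ _ (B i) (B k) val val inlI).
  have sub : subalg_set (C i) `<=` subalg_set (C k).
    apply: sub_smallest2r; first exact: subalg_closed_generated.
    move=> X [l _ [x _ <-]].
    have lk : (l < k)%N by exact: ltn_trans (ltn_ord l) ik.
    have e : widen_ord (leq_ord k) (Ordinal lk) = widen_ord (leq_ord i) l.
      exact: val_inj.
    exists (Ordinal lk) => //; rewrite e; exists x => //.
  move=> _ [p _ <-].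
  by exists (subalg_elt (sub _ (subalg_eltP p))).
Qed.
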